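(* Let $\mathbb{L}=\{(s,\lambda)\in\mathbb{C}^2 : \Re(\lambda)>0,\ \lambda(j-s)\neq(2k+1)\pi i \text{ for all } j,k\in\mathbb{Z},\ j\ge 1\}$. There exists a family of functions $\beta_\lambda$ such that $(s,\lambda)\mapsto\beta_\lambda(s)$ is holomorphic on $\mathbb{L}$. These functions are expressible as the infinite composition $$\beta_\lambda(s)=\mathop{\Omega}_{j=1}^{\infty}\frac{e^z}{e^{\lambda(j-s)}+1}\bullet z,$$ satisfy the functional equation $$\beta_\lambda(s+1)=\frac{e^{\beta_\lambda(s)}}{e^{-\lambda s}+1},$$ and satisfy the asymptotic relationship $$\log(\beta_\lambda(s+1))-\beta_\lambda(s)=\mathcal{O}(e^{-\lambda s})\quad\text{as } |s|\to\infty,\ \text{wherever } \Re(\lambda s)>0.$$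
   Context: For a sequence of functions $h_j(s,\lambda,z)$, the infinite composition is $\mathop{\Omega}_{j=1}^{\infty}h_j(s,\lambda,z)\bullet z=\lim_{n\to\infty}h_1(s,\lambda,h_2(s,\lambda,\dots h_n(s,\lambda,z)))$, the compositions being taken in the variable $z$. Here the limit is constant in $z$, so the value depends only on $(s,\lambda)$. The logarithm of $\beta_\lambda(s+1)$ is understood as the one given by the functional equation, i.e. $\log\beta_\lambda(s+1)=\beta_\lambda(s)-\log(1+e^{-\lambda s})$. The functional equation is understood where both sides are defined.
   Formalization: The O(e^{-λs}) bound is claimed, for each fixed λ and each δ>0, only where Re(λs)>0 and |1+e^{-λs}|≥δ (constants may depend on λ, δ): on the whole half plane it fails, as log(1+e^{-λs}) is unbounded near s=(2k+1)πi/λ. *)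

(* Defs.v *)
From Stdlib Require Import Reals Lra ZArith.
From Coquelicot Require Import Coquelicot.
Open Scope R_scope.
Open Scope C_scope.

Definition Cexp (z : C) : C :=
  ((exp (Re z) * cos (Im z))%R, (exp (Re z) * sin (Im z))%R).

(* Principal argument, in (-PI, PI] for z <> 0. *)
Definition Carg (z : C) : R :=
  if Rlt_dec (Im z) 0 then (- acos (Re z / Cmod z))%R
  else acos (Re z / Cmod z).

(* Principal logarithm (meaningful for z <> 0). *)
Definition Clog (z : C) : C := (ln (Cmod z), Carg z).

Definition LL (s lambda : C) : Prop :=
  0 < Re lambda /\
  forall j k : Z, (1 <= j)%Z ->
    lambda * (RtoC (IZR j) - s) <> RtoC (IZR (2 * k + 1)) * RtoC PI * Ci.

(* Complex Frechet differentiability with respect to the pair, over the scalar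
   field C, in a neighbourhood of every point of U. *)
Definition holomorphic2_on (f : C -> C -> C) (U : C -> C -> Prop) : Prop :=
  forall x y : C, U x y ->
    locally (T := prod_UniformSpace C_UniformSpace C_UniformSpace) (x, y)
      (fun p => ex_filterdiff (K := C_AbsRing)
        (U := prod_NormedModule C_AbsRing C_NormedModule C_NormedModule)
        (V := C_NormedModule)
        (fun q : C * C => f (fst q) (snd q)) (locally p)).

(* [compose_upto h n z] is h_1 (h_2 (... (h_n z))); the value h 0 is unused. *)
Fixpoint compose_upto (h : nat -> C -> C) (n : nat) (z : C) : C :=
  match n with
  | O => z
  | S m => compose_upto h m (h (S m) z)
  end.

(* The infinite composition of the h_j, j >= 1, exists, is constant in z, and
   equals l. *)
Definition is_infinite_composition (h : nat -> C -> C) (l : C) : Prop :=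
  forall z : C, filterlim (fun n => compose_upto h n z) eventually (locally l).

Definition beta_step (s lambda : C) (j : nat) (z : C) : C :=
  Cexp z / (Cexp (lambda * (RtoC (INR j) - s)) + 1).

(* The logarithm of beta_lambda (s + 1) selected by the functional equation
   (see [Cexp_log_beta_succ]).  On the half plane Re (lambda s) > 0 one has
   Re (1 + e^(-lambda s)) > 0, far from the branch cut of [Clog]. *)
Definition log_beta_succ (beta : C -> C -> C) (lambda s : C) : C :=
  beta lambda s - Clog (1 + Cexp (- (lambda * s))).

(* f (s) = O(g (s)) as |s| -> infinity inside D. *)
Definition bigO_infty_within (D : C -> Prop) (f g : C -> C) : Prop :=
  exists M A : R, forall s : C,
    D s -> (A <= Cmod s)%R -> (Cmod (f s) <= M * Cmod (g s))%R.

(* The part of {Re (lambda s) > 0} on which beta_lambda (s) and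
   beta_lambda (s + 1) are defined and 1 + e^(-lambda s) stays at least delta
   away from 0.  Some such delta > 0 is unavoidable: log (1 + e^(-lambda s)) is
   unbounded near the points lambda s = (2k+1) PI i of the boundary line
   Re (lambda s) = 0, where |e^(-lambda s)| = 1, and these points have arbitrarily
   large modulus.  A half plane Re (lambda s) >= eps > 0 satisfies the condition
   with delta = 1 - e^(-eps). *)
Definition asymptotic_domain (lambda : C) (delta : R) (s : C) : Prop :=
  0 < Re (lambda * s) /\ LL s lambda /\ LL (s + 1) lambda /\
  (delta <= Cmod (1 + Cexp (- (lambda * s))))%R.

Lemma Cexp_minus (z w : C) : Cexp w <> 0 -> Cexp (z - w) = Cexp z / Cexp w.
Proof.
intros Hw.
assert (H : Cexp (z - w) * Cexp w = Cexp z).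
{ destruct z as [a b], w as [c d].
  apply injective_projections; unfold Cexp, Cminus, Cplus, Copp, Cmult; simpl.
  - replace (exp a) with (exp (a + - c) * exp c)%R
      by (rewrite <- exp_plus; f_equal; ring).
    replace b with ((b + - d) + d)%R at 3 by ring.
    rewrite (cos_plus (b + - d) d); ring.
  - replace (exp a) with (exp (a + - c) * exp c)%R
      by (rewrite <- exp_plus; f_equal; ring).
    replace b with ((b + - d) + d)%R at 3 by ring.
    rewrite (sin_plus (b + - d) d); ring. }
rewrite <- H; field; exact Hw.
Qed.

Lemma Cexp_Clog (z : C) : z <> 0 -> Cexp (Clog z) = z.
Proof.
intros Hz.
pose proof (Cmod_gt_0 z) as [Hm _]; specialize (Hm Hz).
assert (Hsq : (Re z * Re z + Im z * Im z = Cmod z * Cmod z)%R).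
{ unfold Cmod, Re, Im; rewrite sqrt_sqrt; [ring | nra]. }
assert (Hb : (-1 <= Re z / Cmod z <= 1)%R).
{ split; [apply Rle_div_r | apply Rle_div_l]; try lra; nra. }
assert (Hs : sqrt (1 - (Re z / Cmod z)²) = (Rabs (Im z) / Cmod z)%R).
{ replace (1 - (Re z / Cmod z)²)%R with ((Im z / Cmod z)²).
  - rewrite sqrt_Rsqr_abs; unfold Rdiv; rewrite Rabs_mult, (Rabs_pos_eq (/ _));
      [reflexivity | left; apply Rinv_0_lt_compat; exact Hm].
  - unfold Rsqr; apply Rmult_eq_reg_r with (Cmod z * Cmod z)%R; [| nra].
    field_simplify; [nra | lra | lra]. }
destruct z as [x y].
apply injective_projections; unfold Cexp, Clog, Carg; simpl;
  rewrite (exp_ln _ Hm); unfold Re, Im in *; simpl fst in *; simpl snd in *;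
  destruct (Rlt_dec y 0) as [Hy | Hy].
- rewrite cos_neg, cos_acos by exact Hb; field; lra.
- rewrite cos_acos by exact Hb; field; lra.
- rewrite sin_neg, sin_acos, Hs, Rabs_left by assumption; field; lra.
- rewrite sin_acos, Hs, Rabs_pos_eq by (assumption || lra); field; lra.
Qed.

Lemma Cexp_log_beta_succ (beta : C -> C -> C) (lambda s : C) :
  1 + Cexp (- (lambda * s)) <> 0 ->
  Cexp (log_beta_succ beta lambda s) =
    Cexp (beta lambda s) / (Cexp (- (lambda * s)) + 1).
Proof.
intros H; unfold log_beta_succ.
rewrite Cexp_minus; rewrite (Cexp_Clog _ H); [| exact H].
now rewrite (Cplus_comm 1).
Qed.

(* Main.v *)
Require Import Defs.
From Stdlib Require Import Reals Lra Lia Psatz ZArith ClassicalEpsilon.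
From Coquelicot Require Import Coquelicot.
Open Scope R_scope.
Open Scope C_scope.

(** Put x = e^(-lambda) and w = e^(lambda (s - 1)).  Since
    1 / (e^(lambda (j - s)) + 1) = phi (x^(j-1) w) with phi t = t / (1 + t), the
    partial compositions are the towers
      T_n (x, w, z) = phi w * exp (T_(n-1) (x, x w, z)),   T_0 (x, w, z) = z,
    so everything reduces to the functional iteration
      g |-> ((x, w) |-> phi w * exp (g (x, x w))),
    where |x| < 1 because Re lambda > 0, and 1 + x^n w <> 0 for all n because
    (s, lambda) lies in LL.

    For |w| <= 1/100 one step of the iteration halves distances between values
    of modulus at most 1/2, and the innermost value phi (x^n w) e^z tends to 0
    whatever z is; hence the towers converge to a limit tower_lim that forgets z
    (tower_contract, tower_cvg_small).  For arbitrary w, some x^k w is small, and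
    the k outer steps are continuous functions (tower_cvg).  The limit satisfies
      tower_lim x w = phi w * exp (tower_lim x (x w)),
    which is the functional equation of beta.

    Holomorphy is obtained without Cauchy integrals.  On the bidisc |x| < 1,
    |w| < 1/100, one step of the iteration preserves, with the same constants, a
    Lipschitz bound and a bound on the remainder of the first order Taylor
    expansion that is quadratic in the increment (tame_step).  All towers thus
    have uniformly quadratic remainders; this forces their derivatives to
    converge (slopes_converge) and passes to the limit (tangent_of_tame_limit).
    Outside the bidisc the equation above, used k times, writes tower_lim as a
    composition of holomorphic functions of its values in the bidisc
    (tower_lim_diff); the conditions 1 + x^n w <> 0 keep phi away from its pole.

    Finally log beta (s + 1) - beta (s) = - log (1 + u) with u = e^(-lambda s) and
    |u| < 1.  For small u this is O(u); for |u| >= 1/2 the argument is at most PI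
    and the logarithm of the modulus is controlled by the lower bound on
    |1 + u| (Clog_one_plus_bound). *)

(** * The complex exponential *)

Lemma Cexp_plus (z w : C) : Cexp (z + w) = Cexp z * Cexp w.
Proof.
destruct z as [a b], w as [c d].
apply injective_projections; unfold Cexp, Cplus, Cmult; simpl; rewrite exp_plus.
- rewrite cos_plus; ring.
- rewrite sin_plus; ring.
Qed.

Lemma Cexp_0 : Cexp 0 = 1.
Proof.
apply injective_projections; unfold Cexp; simpl; rewrite exp_0, ?cos_0, ?sin_0; ring.
Qed.

Lemma Cmod_Cexp (z : C) : Cmod (Cexp z) = exp (Re z).
Proof.
unfold Cmod, Cexp; simpl.
replace (_ + _)%R with ((exp (Re z))² * ((sin (Im z))² + (cos (Im z))²))%R
  by (unfold Rsqr; ring).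
rewrite sin2_cos2, Rmult_1_r.
apply sqrt_Rsqr, Rlt_le, exp_pos.
Qed.

Lemma Cexp_neq_0 (z : C) : Cexp z <> 0.
Proof.
apply Cmod_gt_0; rewrite Cmod_Cexp; apply exp_pos.
Qed.

Lemma Cexp_opp (z : C) : Cexp (- z) = / Cexp z.
Proof.
assert (H : Cexp (- z) * Cexp z = 1).
{ rewrite <- Cexp_plus, <- Cexp_0; f_equal; ring. }
rewrite <- (Cmult_1_l (/ Cexp z)), <- H; field; apply Cexp_neq_0.
Qed.

Lemma Cmod_le_abs (z : C) : (Cmod z <= Rabs (Re z) + Rabs (Im z))%R.
Proof.
destruct z as [a b]; unfold Re, Im; simpl.
replace (a, b) with (RtoC a + RtoC b * Ci)
  by (apply injective_projections; simpl; ring).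
apply Rle_trans with (1 := Cmod_triangle _ _).
rewrite Cmod_mult, !Cmod_R.
replace (Cmod Ci) with 1%R; [lra |].
unfold Cmod, Ci; simpl; replace (_ + _)%R with 1%R by ring; now rewrite sqrt_1.
Qed.

Lemma im_le_Cmod (z : C) : (Rabs (Im z) <= Cmod z)%R.
Proof.
apply Rle_trans with (2 := Rmax_Cmod z), Rmax_r.
Qed.

Lemma exp_le_compat (a b : R) : (a <= b -> exp a <= exp b)%R.
Proof.
intros [H | ->]; [left; now apply exp_increasing | right; reflexivity].
Qed.

(** Multiplying by (1 - a/2)^2 <= exp (- a) reduces the upper bound to a
    polynomial inequality on [-1, 1]. *)
Lemma exp_remainder (a : R) :
  (Rabs a <= 1 -> 0 <= exp a - 1 - a <= 2 * (a * a))%R.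
Proof.
intros Ha; apply Rabs_le_between in Ha.
split; [pose proof (exp_ineq1_le a); lra |].
pose proof (exp_ineq1_le (- a / 2)) as Hh.
assert (E : (exp a * (exp (- a / 2) * exp (- a / 2)) = 1)%R).
{ rewrite <- !exp_plus; replace (a + _)%R with 0%R by field; apply exp_0. }
pose proof (exp_pos a) as Hp.
assert (H1 : (exp a * ((1 - a / 2) * (1 - a / 2)) <= 1)%R).
{ rewrite <- E; apply Rmult_le_compat_l; [lra | nra]. }
(* (1 + a + 2 a^2) (1 - a/2)^2 - 1 = a^2 (1 - a) (5 - 2 a) / 4 *)
assert (H2 : ((1 + a + 2 * (a * a)) * ((1 - a / 2) * (1 - a / 2)) >= 1)%R).
{ assert (0 <= (a * a) * ((1 - a) * (5 - 2 * a)))%R; [| lra].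
  apply Rmult_le_pos; nra. }
assert (H3 : (0 < (1 - a / 2) * (1 - a / 2))%R) by nra.
nra.
Qed.

Lemma Rabs_sin_le (b : R) : (Rabs (sin b) <= Rabs b)%R.
Proof.
destruct (MVT_abs sin cos 0 b) as [c [E _]].
{ intros c _; apply derivable_pt_lim_sin. }
rewrite sin_0, !Rminus_0_r in E; rewrite E.
assert (Rabs (cos c) <= 1)%R by (apply Rabs_le_between, COS_bound).
pose proof (Rabs_pos b); nra.
Qed.

Lemma cos_remainder (b : R) : (0 <= 1 - cos b <= b * b / 2)%R.
Proof.
split; [pose proof (COS_bound b); lra |].
assert (E : (cos b = 1 - 2 * sin (b / 2) * sin (b / 2))%R).
{ replace b with (2 * (b / 2))%R at 1 by field; apply cos_2a_sin. }
pose proof (Rsqr_le_abs_1 _ _ (Rabs_sin_le (b / 2))) as H.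
unfold Rsqr in H; lra.
Qed.

(** The derivative of sin t - t is cos t - 1, which is quadratically small. *)
Lemma sin_remainder (b : R) :
  (Rabs b <= 1 -> Rabs (sin b - b) <= b * b / 2)%R.
Proof.
intros Hb.
destruct (MVT_abs (fun t => sin t - t)%R (fun t => cos t - 1)%R 0 b)
  as [c [E Hc]].
{ intros c _; apply derivable_pt_lim_minus;
    [apply derivable_pt_lim_sin | apply derivable_pt_lim_id]. }
rewrite sin_0, !Rminus_0_r in E; rewrite E.
rewrite (Rabs_left1 (cos c - 1)) by (pose proof (COS_bound c); lra).
assert (Hcb : (c * c <= b * b)%R).
{ unfold Rmin, Rmax in Hc; destruct (Rle_dec 0 b); nra. }
pose proof (cos_remainder c); pose proof (Rabs_pos b); nra.
Qed.

(** Real and imaginary parts of Cexp h - 1 - h are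
    (e^a - 1 - a) - e^a (1 - cos b) and (e^a - 1) sin b + (sin b - b) for
    h = a + i b, so the three real remainders give the bound. *)
Lemma Cexp_remainder (h : C) :
  (Cmod h <= 1 -> Cmod (Cexp h - 1 - h) <= 4 * Cmod h ^ 2)%R.
Proof.
intros Hh.
pose proof (re_le_Cmod h) as Hre; pose proof (im_le_Cmod h) as Him.
assert (E : (Cmod h ^ 2 = Re h * Re h + Im h * Im h)%R).
{ unfold Cmod; rewrite pow2_sqrt; unfold Re, Im; [ring | nra]. }
rewrite E; apply Rle_trans with (1 := Cmod_le_abs _).
destruct h as [a b]; unfold Re, Im in *; simpl fst in *; simpl snd in *.
clear E.
destruct (exp_remainder a) as [A1 A2]; [lra |].
destruct (cos_remainder b) as [B1 B2].
pose proof (sin_remainder b ltac:(lra)) as S.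
assert (Ha : (-1 <= a <= 1)%R) by (apply Rabs_le_between; lra).
assert (R1 : (Rabs (exp a * cos b + - 1 + - a) <= 2 * (a * a) + 3 / 2 * (b * b))%R).
{ replace (exp a * cos b + -1 + - a)%R
    with ((exp a - 1 - a) - exp a * (1 - cos b))%R by ring.
  assert (exp a <= 3)%R
    by (apply Rle_trans with (2 := exp_le_3); apply exp_le_compat; lra).
  pose proof (exp_pos a).
  apply Rabs_le; split; nra. }
assert (R2 : (Rabs (exp a * sin b + - 0 + - b)
              <= 3 / 2 * (a * a) + 2 * (b * b))%R).
{ replace (exp a * sin b + - 0 + - b)%R
    with ((exp a - 1) * sin b + (sin b - b))%R by ring.
  apply Rle_trans with (1 := Rabs_triang _ _).
  rewrite Rabs_mult.
  assert (Rabs (exp a - 1) <= 3 * Rabs a)%R.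
  { replace (exp a - 1)%R with ((exp a - 1 - a) + a)%R by ring.
    apply Rle_trans with (1 := Rabs_triang _ _).
    rewrite (Rabs_pos_eq (exp a - 1 - a)) by lra.
    assert (a * a = Rabs a * Rabs a)%R by (rewrite <- Rabs_mult, Rabs_pos_eq; nra).
    pose proof (Rabs_pos a); nra. }
  pose proof (Rabs_sin_le b).
  assert (Rabs (exp a - 1) * Rabs (sin b) <= (3 * Rabs a) * Rabs b)%R
    by (apply Rmult_le_compat; auto using Rabs_pos).
  assert (a * a = Rabs a * Rabs a)%R by (rewrite <- Rabs_mult, Rabs_pos_eq; nra).
  assert (b * b = Rabs b * Rabs b)%R by (rewrite <- Rabs_mult, Rabs_pos_eq; nra).
  pose proof (Rle_0_sqr (Rabs a - Rabs b)) as Q; unfold Rsqr in Q; lra. }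
simpl; apply Rle_trans with (1 := Rplus_le_compat _ _ _ _ R1 R2).
nra.
Qed.

Lemma Cexp_remainder_at (u v : C) :
  (Cmod (v - u) <= 1 ->
   Cmod (Cexp v - Cexp u - Cexp u * (v - u))
     <= 4 * exp (Re u) * Cmod (v - u) ^ 2)%R.
Proof.
intros H.
replace v with (u + (v - u)) at 1 by ring; rewrite Cexp_plus.
replace (_ - _ - _) with (Cexp u * (Cexp (v - u) - 1 - (v - u))) by ring.
rewrite Cmod_mult, Cmod_Cexp.
pose proof (Cexp_remainder _ H); pose proof (exp_pos (Re u)); nra.
Qed.

Lemma Cmod_Cexp_half (u : C) : (Cmod u <= 1 / 2 -> Cmod (Cexp u) <= 2)%R.
Proof.
intros H; rewrite Cmod_Cexp.
pose proof (re_le_Cmod u) as Hr; apply Rabs_le_between in Hr.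
apply Rle_trans with (exp (1 / 2)); [apply exp_le_compat; lra |].
destruct (exp_remainder (1 / 2)) as [_ E]; [rewrite Rabs_pos_eq; lra |].
lra.
Qed.

Lemma Cmod_sub_le (z w : C) : (Cmod (z - w) <= Cmod z + Cmod w)%R.
Proof.
apply Rle_trans with (1 := Cmod_triangle _ _); rewrite Cmod_opp; lra.
Qed.

Lemma Cexp_lipschitz_half (u v : C) :
  (Cmod u <= 1 / 2 -> Cmod v <= 1 / 2 ->
   Cmod (Cexp v - Cexp u) <= 10 * Cmod (v - u))%R.
Proof.
intros Hu Hv.
assert (H1 : (Cmod (v - u) <= 1)%R) by (pose proof (Cmod_sub_le v u); lra).
pose proof (Cexp_remainder_at u v H1) as R.
pose proof (Cmod_Cexp_half u Hu) as E; rewrite Cmod_Cexp in E.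
replace (Cexp v - Cexp u)
  with ((Cexp v - Cexp u - Cexp u * (v - u)) + Cexp u * (v - u)) by ring.
apply Rle_trans with (1 := Cmod_triangle _ _).
rewrite Cmod_mult, Cmod_Cexp.
pose proof (Cmod_ge_0 (v - u)); pose proof (exp_pos (Re u)).
assert (exp (Re u) * Cmod (v - u) ^ 2 <= 2 * Cmod (v - u))%R by nra.
nra.
Qed.

(** * The map t / (1 + t) *)

Definition phi (w : C) : C := w / (1 + w).

(** The exact remainder serves both the bounds that are uniform on a small disc
    and differentiability at every point other than the pole. *)
Lemma phi_remainder_eq (w w' : C) :
  1 + w <> 0 -> 1 + w' <> 0 ->
  phi w' - phi w - / (1 + w) ^ 2 * (w' - w)
  = - ((w' - w) ^ 2 * (/ (1 + w) ^ 2 * / (1 + w'))).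
Proof.
intros H H'; unfold phi; field; split; assumption.
Qed.

Lemma Cmod_inv_one_plus (w : C) :
  (Cmod w <= 1 / 100)%R ->
  1 + w <> 0 /\ (Cmod (/ (1 + w)) <= 100 / 99)%R.
Proof.
intros H.
assert (H1 : (99 / 100 <= Cmod (1 + w))%R).
{ pose proof (Cmod_sub_le (1 + w) w) as T.
  replace (1 + w - w) with (RtoC 1) in T by ring; rewrite Cmod_1 in T; lra. }
assert (H0 : 1 + w <> 0) by (apply Cmod_gt_0; lra).
split; [exact H0 |].
rewrite Cmod_inv by exact H0.
replace (100 / 99)%R with (/ (99 / 100))%R by field.
apply Rinv_le_contravar; lra.
Qed.

Lemma phi_small (w : C) :
  (Cmod w <= 1 / 100 -> Cmod (phi w) <= 2 * Cmod w)%R.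
Proof.
intros H; destruct (Cmod_inv_one_plus w H) as [_ H1].
unfold phi, Cdiv; rewrite Cmod_mult.
pose proof (Cmod_ge_0 w); nra.
Qed.

Lemma dphi_small (w : C) :
  (Cmod w <= 1 / 100 -> Cmod (/ (1 + w) ^ 2) <= 2)%R.
Proof.
intros H; destruct (Cmod_inv_one_plus w H) as [H0 H1].
replace (/ (1 + w) ^ 2) with (/ (1 + w) * / (1 + w)) by (field; exact H0).
rewrite Cmod_mult; pose proof (Cmod_ge_0 (/ (1 + w))); nra.
Qed.

Lemma phi_lipschitz (w w' : C) :
  (Cmod w <= 1 / 100 -> Cmod w' <= 1 / 100 ->
   Cmod (phi w' - phi w) <= 2 * Cmod (w' - w))%R.
Proof.
intros H H'.
destruct (Cmod_inv_one_plus w H) as [H0 H1].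
destruct (Cmod_inv_one_plus w' H') as [H0' H1'].
replace (phi w' - phi w) with ((w' - w) * (/ (1 + w) * / (1 + w')))
  by (unfold phi; field; split; assumption).
rewrite !Cmod_mult.
pose proof (Cmod_ge_0 (/ (1 + w))); pose proof (Cmod_ge_0 (/ (1 + w'))).
pose proof (Cmod_ge_0 (w' - w)).
assert (Cmod (/ (1 + w)) * Cmod (/ (1 + w')) <= 2)%R by nra.
nra.
Qed.

Lemma phi_remainder_small (w w' : C) :
  (Cmod w <= 1 / 100 -> Cmod w' <= 1 / 100 ->
   Cmod (phi w' - phi w - / (1 + w) ^ 2 * (w' - w))
     <= 3 * Cmod (w' - w) ^ 2)%R.
Proof.
intros H H'.
destruct (Cmod_inv_one_plus w H) as [H0 H1].
destruct (Cmod_inv_one_plus w' H') as [H0' H1'].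
rewrite phi_remainder_eq by assumption.
rewrite Cmod_opp, !Cmod_mult, Cmod_pow.
pose proof (dphi_small w H).
pose proof (Cmod_ge_0 (/ (1 + w) ^ 2)); pose proof (Cmod_ge_0 (/ (1 + w'))).
assert (Cmod (/ (1 + w) ^ 2) * Cmod (/ (1 + w')) <= 3)%R by nra.
pose proof (pow2_ge_0 (Cmod (w' - w))); nra.
Qed.

(** * Towers and their contraction *)

(** With x = e^(-lambda) and w = e^(lambda (s - 1)) this is the composition of the
    first n maps z |-> e^z / (e^(lambda (j - s)) + 1): replacing w by x w shifts
    the index j by one. *)
Fixpoint tower (n : nat) (x w z : C) : C :=
  match n with
  | O => z
  | S m => phi w * Cexp (tower m x (x * w) z)
  end.

Lemma Cmod_mul_shrink (x w : C) (r : R) :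
  (Cmod x <= 1 -> Cmod w <= r -> Cmod (x * w) <= r)%R.
Proof.
intros Hx Hw; rewrite Cmod_mult.
pose proof (Cmod_ge_0 w); pose proof (Cmod_ge_0 x); nra.
Qed.

Lemma tower_step_half (w u : C) :
  (Cmod w <= 1 / 100 -> Cmod u <= 1 / 2 -> Cmod (phi w * Cexp u) <= 1 / 2)%R.
Proof.
intros Hw Hu; rewrite Cmod_mult.
pose proof (phi_small w Hw); pose proof (Cmod_Cexp_half u Hu).
pose proof (Cmod_ge_0 (phi w)); pose proof (Cmod_ge_0 (Cexp u)); nra.
Qed.

(** The hypothesis on z only serves the innermost step, where it makes
    |phi (x^n w) e^z| at most 1/2; from there on the disc of radius 1/2 is
    stable. *)
Lemma tower_half (n : nat) (x w z : C) :
  (Cmod x <= 1 -> Cmod w <= 1 / 100 -> Cmod w * exp (Re z) <= 1 / 4 ->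
   Cmod (tower (S n) x w z) <= 1 / 2)%R.
Proof.
revert w; induction n as [| n IH]; intros w Hx Hw Hz.
- simpl; rewrite Cmod_mult, Cmod_Cexp.
  pose proof (phi_small w Hw); pose proof (exp_pos (Re z)); nra.
- change (tower (S (S n)) x w z) with (phi w * Cexp (tower (S n) x (x * w) z)).
  apply tower_step_half; [exact Hw |].
  apply IH; [exact Hx | now apply Cmod_mul_shrink |].
  apply Rle_trans with (2 := Hz), Rmult_le_compat_r;
    [apply Rlt_le, exp_pos | apply Cmod_mul_shrink; lra].
Qed.

(** Each step multiplies distances by at most |phi w| * 10 <= 1/5, and after the
    innermost step all values lie in the disc of radius 1/2.  Starting values z
    and z' may differ, so this yields at once the Cauchy property and the fact
    that the limit does not depend on z. *)
Lemma tower_contract (n a b : nat) (x w z z' : C) :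
  (Cmod x <= 1 -> Cmod w <= 1 / 100 ->
   Cmod w * exp (Re z) <= 1 / 4 -> Cmod w * exp (Re z') <= 1 / 4 ->
   Cmod (tower (S (n + a)) x w z - tower (S (n + b)) x w z') <= (1 / 2) ^ n)%R.
Proof.
revert w; induction n as [| n IH]; intros w Hx Hw Hz Hz'.
- pose proof (tower_half a x w z Hx Hw Hz).
  pose proof (tower_half b x w z' Hx Hw Hz').
  apply Rle_trans with (1 := Cmod_sub_le _ _); simpl (0 + _)%nat.
  rewrite pow_O; lra.
- assert (Hs : forall y : C, (Cmod w * exp (Re y) <= 1 / 4 ->
                              Cmod (x * w) * exp (Re y) <= 1 / 4)%R).
  { intros y Hy; apply Rle_trans with (2 := Hy), Rmult_le_compat_r;
      [apply Rlt_le, exp_pos | apply Cmod_mul_shrink; lra]. }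
  assert (Hw' := Cmod_mul_shrink x w _ Hx Hw).
  specialize (IH (x * w) Hx Hw' (Hs z Hz) (Hs z' Hz')).
  pose proof (tower_half (n + a) x (x * w) z Hx Hw' (Hs z Hz)) as U.
  pose proof (tower_half (n + b) x (x * w) z' Hx Hw' (Hs z' Hz')) as V.
  change (S n + a)%nat with (S (n + a)); change (S n + b)%nat with (S (n + b)).
  change (tower (S (S (n + a))) x w z)
    with (phi w * Cexp (tower (S (n + a)) x (x * w) z)).
  change (tower (S (S (n + b))) x w z')
    with (phi w * Cexp (tower (S (n + b)) x (x * w) z')).
  set (u := tower (S (n + a)) x (x * w) z) in *.
  set (v := tower (S (n + b)) x (x * w) z') in *.
  replace (phi w * Cexp u - phi w * Cexp v)
    with (phi w * (Cexp u - Cexp v)) by ring.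
  rewrite Cmod_mult.
  pose proof (Cexp_lipschitz_half v u V U) as L.
  pose proof (phi_small w Hw).
  pose proof (Cmod_ge_0 (phi w)); pose proof (Cmod_ge_0 (u - v)).
  rewrite <- tech_pow_Rmult; nra.
Qed.

(** * A class of functions stable under the iteration *)

Definition bidisc (x w : C) : Prop :=
  (Cmod x < 1)%R /\ (Cmod w < 1 / 100)%R.

Definition dist1 (x w x' w' : C) : R := (Cmod (x' - x) + Cmod (w' - w))%R.

(** A first order expansion at (x, w) whose remainder is quadratic with a constant
    K valid on the whole bidisc: unlike bare differentiability, this passes to
    pointwise limits. *)
Definition has_tangent (K : R) (f : C -> C -> C) (x w a b : C) : Prop :=
  forall x' w', bidisc x' w' ->
    (Cmod (f x' w' - f x w - (a * (x' - x) + b * (w' - w)))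
       <= K * dist1 x w x' w' ^ 2)%R.

(** The constants are chosen so that tame_step reproduces them.  A Lipschitz
    constant L becomes at most 4 + 2 L / 5, and a quadratic constant K becomes at
    most 471 + 4 K / 25 when L = 10. *)
Record tame (f : C -> C -> C) : Prop := {
  tame_half : forall x w, bidisc x w -> (Cmod (f x w) <= 1 / 2)%R;
  tame_lipschitz : forall x w x' w', bidisc x w -> bidisc x' w' ->
    (Cmod (f x' w' - f x w) <= 10 * dist1 x w x' w')%R;
  tame_tangent : forall x w, bidisc x w ->
    exists a b, (Cmod a <= 10)%R /\ (Cmod b <= 10)%R /\
      has_tangent 1000 f x w a b }.

Lemma bidisc_shrink (x w : C) : bidisc x w -> bidisc x (x * w).
Proof.
intros [Hx Hw]; split; [exact Hx |].
rewrite Cmod_mult; pose proof (Cmod_ge_0 w); pose proof (Cmod_ge_0 x); nra.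
Qed.

Lemma dist1_ge_0 (x w x' w' : C) : (0 <= dist1 x w x' w')%R.
Proof.
unfold dist1; pose proof (Cmod_ge_0 (x' - x)); pose proof (Cmod_ge_0 (w' - w)); lra.
Qed.

(** In dist1 the map (x, w) |-> (x, x w) expands by a factor up to 2 (in fact
    little more than 1); the smallness of phi makes up for it. *)
Lemma dist1_shrink (x w x' w' : C) :
  bidisc x w -> bidisc x' w' ->
  (dist1 x (x * w) x' (x' * w') <= 2 * dist1 x w x' w')%R.
Proof.
intros [_ Hw] [Hx' _]; unfold dist1.
replace (x' * w' - x * w) with (x' * (w' - w) + w * (x' - x)) by ring.
pose proof (Cmod_triangle (x' * (w' - w)) (w * (x' - x))) as T.
rewrite !Cmod_mult in T.
pose proof (Cmod_ge_0 (x' - x)); pose proof (Cmod_ge_0 (w' - w)).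
nra.
Qed.

Lemma tame_const_0 : tame (fun _ _ => 0).
Proof.
split.
- intros; rewrite Cmod_0; lra.
- intros; replace (0 - 0) with (RtoC 0) by ring; rewrite Cmod_0.
  pose proof (dist1_ge_0 x w x' w'); lra.
- intros x w _; exists 0, 0; rewrite Cmod_0; repeat split; try lra.
  intros x' w' _.
  replace (_ - _ - _) with (RtoC 0) by ring; rewrite Cmod_0.
  pose proof (pow2_ge_0 (dist1 x w x' w')); lra.
Qed.

(** The product and chain rules with explicit error terms.  The coefficients of
    the new tangent are the partial derivatives of phi w * Cexp (g (x, x w)). *)
Lemma tame_step (g : C -> C -> C) :
  tame g -> tame (fun x w => phi w * Cexp (g x (x * w))).
Proof.
intros [G1 G2 G3]; split.
- intros x w H; apply tower_step_half; [destruct H; lra |].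
  now apply G1, bidisc_shrink.
- intros x w x' w' H H'.
  set (u := g x (x * w)); set (u' := g x' (x' * w')).
  assert (Hu : (Cmod u <= 1 / 2)%R) by now apply G1, bidisc_shrink.
  assert (Hu' : (Cmod u' <= 1 / 2)%R) by now apply G1, bidisc_shrink.
  assert (D : (Cmod (u' - u) <= 20 * dist1 x w x' w')%R).
  { apply Rle_trans with (1 := G2 _ _ _ _ (bidisc_shrink _ _ H)
      (bidisc_shrink _ _ H')).
    pose proof (dist1_shrink x w x' w' H H'); lra. }
  replace (phi w' * Cexp u' - phi w * Cexp u)
    with ((phi w' - phi w) * Cexp u' + phi w * (Cexp u' - Cexp u)) by ring.
  apply Rle_trans with (1 := Cmod_triangle _ _); rewrite !Cmod_mult.
  destruct H as [Hx Hw]; destruct H' as [Hx' Hw'].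
  pose proof (phi_lipschitz w w' ltac:(lra) ltac:(lra)) as P.
  pose proof (phi_small w ltac:(lra)) as P0.
  pose proof (Cmod_Cexp_half u' Hu') as E.
  pose proof (Cexp_lipschitz_half u u' Hu Hu') as L.
  assert (Dw : (Cmod (w' - w) <= dist1 x w x' w')%R)
    by (unfold dist1; pose proof (Cmod_ge_0 (x' - x)); lra).
  assert (A1 : (Cmod (phi w' - phi w) * Cmod (Cexp u')
                <= (2 * dist1 x w x' w') * 2)%R)
    by (apply Rmult_le_compat; try apply Cmod_ge_0; lra).
  assert (A2 : (Cmod (phi w) * Cmod (Cexp u' - Cexp u)
                <= (2 / 100) * (200 * dist1 x w x' w'))%R)
    by (apply Rmult_le_compat; try apply Cmod_ge_0; lra).
  pose proof (dist1_ge_0 x w x' w'); lra.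
- intros x w H.
  destruct (G3 x (x * w) (bidisc_shrink _ _ H)) as (a & b & Ha & Hb & T).
  set (u := g x (x * w)).
  assert (Hu : (Cmod u <= 1 / 2)%R) by now apply G1, bidisc_shrink.
  pose proof (Cmod_Cexp_half u Hu) as E.
  destruct H as [Hx Hw].
  pose proof (phi_small w ltac:(lra)) as P0.
  pose proof (dphi_small w ltac:(lra)) as P1.
  assert (PE : (Cmod (phi w * Cexp u) <= 1 / 25)%R).
  { rewrite Cmod_mult; replace (1 / 25)%R with (1 / 50 * 2)%R by field.
    apply Rmult_le_compat; try apply Cmod_ge_0; lra. }
  exists (phi w * Cexp u * (a + b * w)),
    (/ (1 + w) ^ 2 * Cexp u + phi w * Cexp u * (b * x)).
  repeat split.
  + rewrite Cmod_mult.
    assert (Cmod (a + b * w) <= 20)%R.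
    { apply Rle_trans with (1 := Cmod_triangle _ _); rewrite Cmod_mult.
      pose proof (Cmod_ge_0 b); pose proof (Cmod_ge_0 w); nra. }
    pose proof (Cmod_ge_0 (a + b * w)); pose proof (Cmod_ge_0 (phi w * Cexp u)); nra.
  + apply Rle_trans with (1 := Cmod_triangle _ _).
    rewrite (Cmod_mult (/ _)), (Cmod_mult (phi w * Cexp u)).
    assert (Cmod (b * x) <= 10)%R.
    { rewrite Cmod_mult; pose proof (Cmod_ge_0 b); pose proof (Cmod_ge_0 x); nra. }
    assert (Cmod (/ (1 + w) ^ 2) * Cmod (Cexp u) <= 2 * 2)%R
      by (apply Rmult_le_compat; try apply Cmod_ge_0; lra).
    assert (Cmod (phi w * Cexp u) * Cmod (b * x) <= 1 / 25 * 10)%R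
      by (apply Rmult_le_compat; try apply Cmod_ge_0; lra).
    lra.
  + intros x' w' H'.
    assert (H : bidisc x w) by (split; assumption).
    specialize (T _ _ (bidisc_shrink _ _ H')).
    pose proof (G2 _ _ _ _ (bidisc_shrink _ _ H) (bidisc_shrink _ _ H')) as L.
    pose proof (dist1_shrink x w x' w' H H') as S.
    pose proof (dist1_ge_0 x (x * w) x' (x' * w')) as S0.
    fold u in T, L; set (u' := g x' (x' * w')) in *.
    assert (Hu' : (Cmod u' <= 1 / 2)%R) by now apply G1, bidisc_shrink.
    pose proof (dist1_ge_0 x w x' w') as D0.
    assert (Dx : (Cmod (x' - x) <= dist1 x w x' w')%R)
      by (unfold dist1; pose proof (Cmod_ge_0 (w' - w)); lra).
    assert (Dw : (Cmod (w' - w) <= dist1 x w x' w')%R)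
      by (unfold dist1; pose proof (Cmod_ge_0 (x' - x)); lra).
    set (d2 := dist1 x (x * w) x' (x' * w')) in *.
    set (d := dist1 x w x' w') in *.
    destruct H' as [Hx' Hw'].
    pose proof (phi_lipschitz w w' ltac:(lra) ltac:(lra)) as P.
    pose proof (phi_remainder_small w w' ltac:(lra) ltac:(lra)) as P2.
    pose proof (Cexp_lipschitz_half u u' Hu Hu') as LE.
    assert (RE : (Cmod (Cexp u' - Cexp u - Cexp u * (u' - u))
                  <= 8 * Cmod (u' - u) ^ 2)%R).
    { apply Rle_trans with (1 := Cexp_remainder_at u u'
        ltac:(pose proof (Cmod_sub_le u' u); lra)).
      rewrite Cmod_Cexp in E; pose proof (pow2_ge_0 (Cmod (u' - u))); nra. }
    assert (U : (Cmod (u' - u) <= 20 * d)%R) by lra.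
    assert (Sq : forall y B : R, (0 <= y <= B -> y ^ 2 <= B ^ 2)%R)
      by (intros; apply pow_incr; assumption).
    assert (U2 : (Cmod (u' - u) ^ 2 <= 400 * d ^ 2)%R).
    { apply Rle_trans with (1 := Sq _ (20 * d)%R ltac:(split;
        [apply Cmod_ge_0 | exact U])); apply Req_le; ring. }
    assert (W2 : (Cmod (w' - w) ^ 2 <= d ^ 2)%R)
      by (apply Sq; split; [apply Cmod_ge_0 | exact Dw]).
    assert (S2 : (d2 ^ 2 <= 4 * d ^ 2)%R).
    { apply Rle_trans with (1 := Sq d2 (2 * d)%R (conj S0 S)).
      apply Req_le; ring. }
    cbv beta; fold u u'.
    (* the product of the two increments, the curvature of phi, the curvature of
       Cexp, and the remainder of the argument u, where the last term comes from
       the curvature of the product x w *)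
    replace (_ - _ - _) with
      ((phi w' - phi w) * (Cexp u' - Cexp u)
       + ((phi w' - phi w - / (1 + w) ^ 2 * (w' - w)) * Cexp u
          + (phi w * (Cexp u' - Cexp u - Cexp u * (u' - u))
             + phi w * Cexp u
               * ((u' - u - (a * (x' - x) + b * (x' * w' - x * w)))
                  + b * ((x' - x) * (w' - w)))))) by ring.
    assert (B1 : (Cmod ((phi w' - phi w) * (Cexp u' - Cexp u))
                  <= 400 * d ^ 2)%R).
    { rewrite Cmod_mult; replace (400 * d ^ 2)%R with (2 * d * (200 * d))%R by ring.
      apply Rmult_le_compat; try apply Cmod_ge_0; lra. }
    assert (B2 : (Cmod ((phi w' - phi w - / (1 + w) ^ 2 * (w' - w)) * Cexp u)
                  <= 6 * d ^ 2)%R).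
    { rewrite Cmod_mult; replace (6 * d ^ 2)%R with (3 * d ^ 2 * 2)%R by ring.
      apply Rmult_le_compat; try apply Cmod_ge_0; lra. }
    assert (B3 : (Cmod (phi w * (Cexp u' - Cexp u - Cexp u * (u' - u)))
                  <= 64 * d ^ 2)%R).
    { rewrite Cmod_mult; replace (64 * d ^ 2)%R with (1 / 50 * (3200 * d ^ 2))%R by field.
      apply Rmult_le_compat; try apply Cmod_ge_0; lra. }
    assert (B4 : (Cmod (phi w * Cexp u
               * ((u' - u - (a * (x' - x) + b * (x' * w' - x * w)))
                  + b * ((x' - x) * (w' - w)))) <= 200 * d ^ 2)%R).
    { rewrite Cmod_mult.
      replace (200 * d ^ 2)%R with (1 / 25 * (5000 * d ^ 2))%R by field.
      apply Rmult_le_compat; try apply Cmod_ge_0; [exact PE |].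
      apply Rle_trans with (1 := Cmod_triangle _ _).
      rewrite !(Cmod_mult b), Cmod_mult.
      assert (Cmod (x' - x) * Cmod (w' - w) <= d * d)%R
        by (apply Rmult_le_compat; try apply Cmod_ge_0; assumption).
      assert (Cmod b * (Cmod (x' - x) * Cmod (w' - w)) <= 10 * (d * d))%R.
      { apply Rmult_le_compat; try assumption; [apply Cmod_ge_0 |].
        apply Rmult_le_pos; apply Cmod_ge_0. }
      pose proof (pow2_ge_0 d); nra. }
    apply Rle_trans with (1 := Cmod_triangle _ _).
    apply Rle_trans with (1 := Rplus_le_compat_l _ _ _ (Cmod_triangle _ _)).
    apply Rle_trans with (1 := Rplus_le_compat_l _ _ _
      (Rplus_le_compat_l _ _ _ (Cmod_triangle _ _))).
    pose proof (pow2_ge_0 d); lra.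
Qed.

Lemma tame_tower (n : nat) : tame (fun x w => tower n x w 0).
Proof.
induction n as [| n IH]; [exact tame_const_0 | exact (tame_step _ IH)].
Qed.

(** * Limits of sequences of complex numbers and of tame functions *)

Definition tends (u : nat -> C) (l : C) : Prop :=
  filterlim u eventually (locally l).

Lemma tends_Cmod (u : nat -> C) (l : C) :
  tends u l <->
  forall eps : R, (0 < eps)%R ->
    exists N, forall n, (N <= n)%nat -> (Cmod (u n - l) < eps)%R.
Proof.
unfold tends; split.
- intros H eps He.
  exact (proj1 (filterlim_locally_ball_norm (U := C_NormedModule) u l) H
           (mkposreal eps He)).
- intros H; apply (filterlim_locally_ball_norm (U := C_NormedModule) u l).
  intros [eps He]; exact (H eps He).
Qed.

Lemma tends_cauchy (u : nat -> C) :
  (exists l, tends u l) <->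
  forall eps : R, (0 < eps)%R ->
    exists N, forall n m, (N <= n)%nat -> (N <= m)%nat ->
      (Cmod (u n - u m) < eps)%R.
Proof.
split.
- intros [l Hl] eps He.
  destruct (proj1 (tends_Cmod u l) Hl (eps / 2)%R ltac:(lra)) as [N HN].
  exists N; intros n m Hn Hm.
  replace (u n - u m) with ((u n - l) - (u m - l)) by ring.
  apply Rle_lt_trans with (1 := Cmod_sub_le _ _).
  pose proof (HN n Hn); pose proof (HN m Hm); lra.
- intros H.
  apply (filterlim_locally_cauchy (U := C_CompleteNormedModule) u).
  intros [eps He]; destruct (H eps He) as [N HN].
  exists (fun n => (N <= n)%nat); split; [now exists N |].
  intros n m Hn Hm; apply (norm_compat1 (V := C_NormedModule)).
  exact (HN m n Hm Hn).
Qed.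

Lemma tends_unique (u : nat -> C) (l l' : C) : tends u l -> tends u l' -> l = l'.
Proof.
exact (filterlim_locally_unique (V := C_NormedModule) u l l').
Qed.

Lemma tends_Cmod_le (u : nat -> C) (l : C) (B : R) :
  tends u l -> (forall n, Cmod (u n) <= B)%R -> (Cmod l <= B)%R.
Proof.
intros Hl HB; apply le_epsilon; intros eps He.
destruct (proj1 (tends_Cmod u l) Hl eps He) as [N HN].
replace l with (u N - (u N - l)) by ring.
apply Rle_trans with (1 := Cmod_sub_le _ _).
pose proof (HB N); pose proof (HN N (le_n N)); lra.
Qed.

Lemma tends_continuous (f : C -> C) (u : nat -> C) (l : C) :
  continuous f l -> tends u l -> tends (fun n => f (u n)) (f l).
Proof.
intros Hf Hu; exact (filterlim_comp _ _ _ u f _ _ _ Hu Hf).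
Qed.

Lemma tends_plus (u v : nat -> C) (l m : C) :
  tends u l -> tends v m -> tends (fun n => u n + v n) (l + m).
Proof.
intros Hu Hv; unfold tends.
exact (filterlim_comp_2 u v Cplus Hu Hv (filterlim_plus (V := C_NormedModule) l m)).
Qed.

Lemma tends_scal (u : nat -> C) (l c : C) :
  tends u l -> tends (fun n => c * u n) (c * l).
Proof.
apply (tends_continuous (fun z => c * z)).
exact (filterlim_scal_r (V := C_NormedModule) c l).
Qed.

Lemma tends_succ (u : nat -> C) (l : C) :
  tends (fun n => u (S n)) l <-> tends u l.
Proof.
rewrite !tends_Cmod; split; intros H eps He; destruct (H eps He) as [N HN].
- exists (S N); intros [| n] Hn; [lia | apply HN; lia].
- exists N; intros n Hn; apply HN; lia.
Qed.

(** The linearised increments a_n t differ from the convergent sequences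
    d_n(t) - c_n by at most K t^2, uniformly in n, so that a_n is Cauchy up to an
    error 2 K t, and t is arbitrary.  This is what replaces Weierstrass's theorem
    on uniform limits of holomorphic functions. *)
Lemma slopes_converge (K r : R) (a c : nat -> C) (d : R -> nat -> C) :
  (0 <= K -> 0 < r ->
   (exists l, tends c l) ->
   (forall t, 0 < t < r -> exists l, tends (d t) l) ->
   (forall t n, 0 < t < r -> Cmod (d t n - c n - a n * t) <= K * t ^ 2) ->
   exists l, tends a l)%R.
Proof.
intros HK Hr Hc Hd Ha; apply tends_cauchy; intros eps He.
(* the linearisation errors amount to at most 2 K t <= eps / 4 *)
set (t := Rmin (r / 2) (eps / (8 * (K + 1)))).
assert (Ht1 : (t <= r / 2)%R) by apply Rmin_l.
assert (Ht2 : (t * (8 * (K + 1)) <= eps)%R).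
{ apply Rle_div_r; [lra | apply Rmin_r]. }
assert (Ht0 : (0 < t)%R).
{ apply Rmin_pos; [lra | apply Rdiv_lt_0_compat; lra]. }
assert (Ht : (0 < t < r)%R) by lra.
assert (He' : (0 < t * eps / 4)%R) by nra.
destruct (proj1 (tends_cauchy c) Hc _ He') as [N1 H1].
destruct (proj1 (tends_cauchy (d t)) (Hd t Ht) _ He') as [N2 H2].
exists (max N1 N2); intros n m Hn Hm.
specialize (H1 n m ltac:(lia) ltac:(lia)).
specialize (H2 n m ltac:(lia) ltac:(lia)).
pose proof (Ha t n Ht) as An; pose proof (Ha t m Ht) as Am.
assert (E : (t * Cmod (a n - a m) = Cmod ((a n - a m) * t))%R).
{ rewrite Cmod_mult, Cmod_R, Rabs_pos_eq by lra; ring. }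
replace ((a n - a m) * t) with
  ((d t n - d t m) - (c n - c m)
   - ((d t n - c n - a n * t) - (d t m - c m - a m * t))) in E by ring.
pose proof (Cmod_sub_le ((d t n - d t m) - (c n - c m))
  ((d t n - c n - a n * t) - (d t m - c m - a m * t))).
pose proof (Cmod_sub_le (d t n - d t m) (c n - c m)).
pose proof (Cmod_sub_le (d t n - c n - a n * t) (d t m - c m - a m * t)).
assert (t * Cmod (a n - a m) < t * eps)%R by nra.
nra.
Qed.

(** The partial derivatives of F n at (x, w) converge by slopes_converge along
    real increments in each variable, and the quadratic bound is a closed
    condition. *)
Lemma tangent_of_tame_limit (F : nat -> C -> C -> C) (f : C -> C -> C) :
  (forall n, tame (F n)) ->
  (forall x w, bidisc x w -> tends (fun n => F n x w) (f x w)) ->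
  forall x w, bidisc x w -> exists a b, has_tangent 1000 f x w a b.
Proof.
intros HF Hf x w H.
assert (Hab : forall n, { ab : C * C | has_tangent 1000 (F n) x w (fst ab) (snd ab) }).
{ intros n; apply constructive_indefinite_description.
  destruct (tame_tangent _ (HF n) x w H) as (a & b & _ & _ & T).
  now exists (a, b). }
pose (a n := fst (proj1_sig (Hab n))); pose (b n := snd (proj1_sig (Hab n))).
assert (T : forall n, has_tangent 1000 (F n) x w (a n) (b n))
  by (intros n; exact (proj2_sig (Hab n))).
destruct H as [Hx Hw].
assert (Hdx : forall t : R, (0 < t < 1 - Cmod x)%R -> bidisc (x + t) w).
{ intros t Ht; split; [| exact Hw].
  apply Rle_lt_trans with (1 := Cmod_triangle _ _).
  rewrite Cmod_R, Rabs_pos_eq; lra. }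
assert (Hdw : forall t : R, (0 < t < 1 / 100 - Cmod w)%R -> bidisc x (w + t)).
{ intros t Ht; split; [exact Hx |].
  apply Rle_lt_trans with (1 := Cmod_triangle _ _).
  rewrite Cmod_R, Rabs_pos_eq; lra. }
assert (Hc : exists l, tends (fun n => F n x w) l)
  by (exists (f x w); now apply Hf).
destruct (slopes_converge 1000 (1 - Cmod x) a (fun n => F n x w)
  (fun t n => F n (x + t) w)) as [la Hla]; try lra; [exact Hc | | |].
{ intros t Ht; exists (f (x + t) w); now apply Hf, Hdx. }
{ intros t n Ht; pose proof (T n (x + t) w (Hdx t Ht)) as P.
  unfold dist1 in P.
  replace (w - w) with (RtoC 0) in P by ring.
  replace (x + t - x) with (RtoC t) in P by ring.
  rewrite Cmod_0, Cmod_R, (Rabs_pos_eq t), Rplus_0_r in P by lra.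
  replace (a n * t) with (a n * t + b n * 0) by ring; exact P. }
destruct (slopes_converge 1000 (1 / 100 - Cmod w) b (fun n => F n x w)
  (fun t n => F n x (w + t))) as [lb Hlb]; try lra; [exact Hc | | |].
{ intros t Ht; exists (f x (w + t)); now apply Hf, Hdw. }
{ intros t n Ht; pose proof (T n x (w + t) (Hdw t Ht)) as P.
  unfold dist1 in P.
  replace (x - x) with (RtoC 0) in P by ring.
  replace (w + t - w) with (RtoC t) in P by ring.
  rewrite Cmod_0, Cmod_R, (Rabs_pos_eq t), Rplus_0_l in P by lra.
  replace (b n * t) with (a n * 0 + b n * t) by ring; exact P. }
exists la, lb; intros x' w' H'.
apply tends_Cmod_le with
  (u := fun n => F n x' w' + ((- (1)) * F n x w
           + (- (1)) * ((x' - x) * a n + (w' - w) * b n))).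
- replace (f x' w' - f x w - (la * (x' - x) + lb * (w' - w)))
    with (f x' w' + ((- (1)) * f x w
           + (- (1)) * ((x' - x) * la + (w' - w) * lb))) by ring.
  apply tends_plus; [now apply Hf |].
  apply tends_plus; [apply tends_scal, Hf; split; assumption |].
  apply tends_scal, tends_plus; apply tends_scal; assumption.
- intros n; pose proof (T n x' w' H') as P.
  replace (_ + _) with (F n x' w' - F n x w - (a n * (x' - x) + b n * (w' - w)))
    by ring; exact P.
Qed.

(** * Differentiability in one complex variable *)

Lemma filterdiff_of_quadratic_remainder {K : AbsRing} {U V : NormedModule K}
  (f l : U -> V) (x : U) (r M : R) :
  is_linear l -> (0 < r)%R ->
  (forall y, (norm (minus y x) < r)%R ->
     (norm (minus (minus (f y) (f x)) (l (minus y x)))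
        <= M * norm (minus y x) ^ 2)%R) ->
  filterdiff f (locally x) l.
Proof.
intros Hl Hr H; split; [exact Hl |]; intros y Hy.
apply (is_filter_lim_locally_unique (V := U)) in Hy; subst y.
intros [eps He].
assert (Hd : (0 < Rmin r (eps / (Rabs M + 1)))%R).
{ pose proof (Rabs_pos M).
  apply Rmin_pos; [exact Hr | apply Rdiv_lt_0_compat; lra]. }
apply (locally_le_locally_norm x); exists (mkposreal _ Hd); intros y Hy.
change (norm (minus y x) < Rmin r (eps / (Rabs M + 1)))%R in Hy; simpl.
apply Rle_trans with (1 := H y (Rlt_le_trans _ _ _ Hy (Rmin_l _ _))).
assert (Hy' : (norm (minus y x) * (Rabs M + 1) <= eps)%R).
{ apply Rlt_le, Rlt_div_r; [pose proof (Rabs_pos M); lra |].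
  exact (Rlt_le_trans _ _ _ Hy (Rmin_r _ _)). }
pose proof (norm_ge_0 (minus y x)); pose proof (Rle_abs M).
assert (M * norm (minus y x) <= eps)%R by nra.
nra.
Qed.

Lemma C_mult_comm (n m : C_AbsRing) : mult n m = mult m n.
Proof. exact (Cmult_comm n m). Qed.

Notation Cdiff f z :=
  (ex_filterdiff (U := C_NormedModule) (V := C_NormedModule) f (locally z)).

Lemma Cexp_diff (z : C) : Cdiff Cexp z.
Proof.
exists (fun h : C => Cexp z * h).
apply (filterdiff_of_quadratic_remainder (U := C_NormedModule)
  (V := C_NormedModule) _ _ _ 1 (4 * exp (Re z))%R).
- exact (is_linear_scal_r (V := C_NormedModule) (Cexp z) C_mult_comm).
- lra.
- intros y Hy; apply Cexp_remainder_at, Rlt_le, Hy.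
Qed.

Lemma phi_diff (w : C) : 1 + w <> 0 -> Cdiff phi w.
Proof.
intros H; exists (fun h : C => / (1 + w) ^ 2 * h).
pose proof (proj1 (Cmod_gt_0 _) H) as Hm.
apply (filterdiff_of_quadratic_remainder (U := C_NormedModule)
  (V := C_NormedModule) _ _ _ (Cmod (1 + w) / 2)
  (Cmod (/ (1 + w) ^ 2) * / (Cmod (1 + w) / 2))%R).
- exact (is_linear_scal_r (V := C_NormedModule) (/ (1 + w) ^ 2) C_mult_comm).
- lra.
- intros w' Hw'; change (Cmod (w' - w) < Cmod (1 + w) / 2)%R in Hw'.
  change (Cmod (phi w' - phi w - / (1 + w) ^ 2 * (w' - w))
    <= Cmod (/ (1 + w) ^ 2) * / (Cmod (1 + w) / 2) * Cmod (w' - w) ^ 2)%R.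
  assert (Hm' : (Cmod (1 + w) / 2 <= Cmod (1 + w'))%R).
  { pose proof (Cmod_sub_le (1 + w') (w' - w)) as T.
    replace (1 + w' - (w' - w)) with (1 + w) in T by ring; lra. }
  assert (H' : 1 + w' <> 0) by (apply Cmod_gt_0; lra).
  rewrite phi_remainder_eq, Cmod_opp, !Cmod_mult, Cmod_pow by assumption.
  rewrite (Rmult_comm _ (Cmod (w' - w) ^ 2)).
  apply Rmult_le_compat_l; [apply pow2_ge_0 |].
  apply Rmult_le_compat_l; [apply Cmod_ge_0 |].
  rewrite Cmod_inv by exact H'; apply Rinv_le_contravar; lra.
Qed.

(** * Convergence of the towers *)

Lemma tower_cvg_small (x w z : C) :
  (Cmod x <= 1)%R -> (Cmod w <= 1 / 100)%R -> (Cmod w * exp (Re z) <= 1 / 4)%R ->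
  exists l, tends (fun n => tower n x w 0) l /\ tends (fun n => tower n x w z) l.
Proof.
intros Hx Hw Hz.
assert (H0 : (Cmod w * exp (Re 0) <= 1 / 4)%R)
  by (unfold Re; simpl; rewrite exp_0; lra).
assert (Hp : forall eps : R, (0 < eps)%R -> exists N, ((1 / 2) ^ N < eps)%R).
{ intros eps He.
  destruct (pow_lt_1_zero (1 / 2) ltac:(rewrite Rabs_pos_eq; lra) eps He) as [N HN].
  exists N; specialize (HN N (le_n N)).
  rewrite Rabs_pos_eq in HN; [exact HN | apply pow_le; lra]. }
assert (Hc : exists l, tends (fun n => tower (S n) x w 0) l).
{ apply tends_cauchy; intros eps He; destruct (Hp eps He) as [N HN].
  exists N; intros n m Hn Hm.
  apply Rle_lt_trans with (2 := HN).
  replace n with (N + (n - N))%nat by lia; replace m with (N + (m - N))%nat by lia.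
  now apply tower_contract. }
destruct Hc as [l Hl]; exists l; split; apply tends_succ; [exact Hl |].
replace l with (l + 0) by ring.
assert (Hd : tends (fun n => tower (S n) x w z - tower (S n) x w 0) 0).
{ apply tends_Cmod; intros eps He; destruct (Hp eps He) as [N HN].
  exists N; intros n Hn; apply Rle_lt_trans with (2 := HN).
  replace (_ - _ - 0) with (tower (S n) x w z - tower (S n) x w 0) by ring.
  replace n with (N + (n - N))%nat by lia.
  now apply tower_contract. }
apply (filterlim_ext (fun n => tower (S n) x w 0
                               + (tower (S n) x w z - tower (S n) x w 0))).
{ intros n; ring. }
exact (tends_plus _ _ _ _ Hl Hd).
Qed.

Lemma Cexp_continuous (z : C) : continuous Cexp z.
Proof.
exact (filterdiff_continuous (K := C_AbsRing) Cexp z (Cexp_diff z)).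
Qed.

Lemma tends_step (w l : C) (u : nat -> C) :
  tends u l -> tends (fun n => phi w * Cexp (u n)) (phi w * Cexp l).
Proof.
intros H; apply tends_scal, (tends_continuous Cexp); [| exact H].
apply Cexp_continuous.
Qed.

(** A tower over w of height n + k consists of k continuous steps applied to the
    tower of height n over x^k w. *)
Lemma tower_cvg_shifted (k : nat) (x w z : C) :
  (exists l, tends (fun n => tower n x (x ^ k * w) 0) l
             /\ tends (fun n => tower n x (x ^ k * w) z) l) ->
  exists l, tends (fun n => tower n x w 0) l /\ tends (fun n => tower n x w z) l.
Proof.
revert w; induction k as [| k IH]; intros w H.
- now replace (x ^ 0 * w) with w in H by (simpl; ring).
- replace (x ^ S k * w) with (x ^ k * (x * w)) in H by (simpl; ring).
  destruct (IH _ H) as (l & H0 & Hz).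
  exists (phi w * Cexp l); split; apply tends_succ; now apply tends_step.
Qed.

Lemma pow_mul_small (x w : C) (eps : R) :
  (Cmod x < 1)%R -> (0 < eps)%R -> exists k, (Cmod (x ^ k * w) < eps)%R.
Proof.
intros Hx He.
pose proof (Cmod_ge_0 w) as W.
destruct (pow_lt_1_zero (Cmod x) ltac:(rewrite Rabs_pos_eq; [exact Hx | apply Cmod_ge_0])
  (eps / (Cmod w + 1)) ltac:(apply Rdiv_lt_0_compat; lra)) as [k Hk].
exists k; specialize (Hk k (le_n k)).
rewrite Rabs_pos_eq in Hk by (apply pow_le, Cmod_ge_0).
apply Rlt_div_r in Hk; [| lra].
rewrite Cmod_mult, Cmod_pow.
pose proof (pow_le (Cmod x) k (Cmod_ge_0 x)); nra.
Qed.

Definition tower_lim (x w : C) : C :=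
  lim (T := C_CompleteNormedModule) (filtermap (fun n => tower n x w 0) eventually).

Lemma tower_cvg (x w z : C) :
  (Cmod x < 1)%R -> tends (fun n => tower n x w z) (tower_lim x w).
Proof.
intros Hx.
set (eps := Rmin (1 / 100) (1 / 4 * / exp (Re z))).
assert (He : (0 < eps)%R).
{ pose proof (Rinv_0_lt_compat _ (exp_pos (Re z))); apply Rmin_pos; lra. }
destruct (pow_mul_small x w eps Hx He) as [k Hk].
assert (H : exists l, tends (fun n => tower n x w 0) l
                      /\ tends (fun n => tower n x w z) l).
{ apply (tower_cvg_shifted k), tower_cvg_small; [lra | |].
  - apply Rlt_le, Rlt_le_trans with (1 := Hk), Rmin_l.
  - pose proof (exp_pos (Re z)).
    replace (1 / 4)%R with (1 / 4 * / exp (Re z) * exp (Re z))%R by (field; lra).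
    apply Rmult_le_compat_r; [lra |].
    apply Rlt_le, Rlt_le_trans with (1 := Hk), Rmin_r. }
destruct H as (l & H0 & Hz).
replace (tower_lim x w) with l; [exact Hz |].
apply (tends_unique _ _ _ H0).
intros P [e HP]; unfold filtermap.
apply (filter_imp (F := eventually)
  (fun n => ball (tower_lim x w) e (tower n x w 0))); [intros n; apply HP |].
apply (complete_cauchy (T := C_CompleteNormedModule)
  (filtermap (fun n => tower n x w 0) eventually)).
- apply filtermap_proper_filter; apply eventually_filter.
- intros e'; exists l; exact (H0 _ (locally_ball l e')).
Qed.

Lemma tower_lim_eq (x w : C) :
  (Cmod x < 1)%R -> tower_lim x w = phi w * Cexp (tower_lim x (x * w)).
Proof.
intros Hx; apply (tends_unique (fun n => tower n x w 0)).
- now apply tower_cvg.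
- apply tends_succ, tends_step; now apply tower_cvg.
Qed.

(** * Differentiability in two complex variables *)

Notation CC := (prod_NormedModule C_AbsRing C_NormedModule C_NormedModule).

Notation CCdiff f p :=
  (ex_filterdiff (K := C_AbsRing) (U := CC) (V := C_NormedModule) f (locally p)).

Lemma CCdiff_fst (p : CC) : CCdiff (fun q : CC => fst q) p.
Proof.
apply ex_filterdiff_linear, is_linear_fst.
Qed.

Lemma CCdiff_snd (p : CC) : CCdiff (fun q : CC => snd q) p.
Proof.
apply ex_filterdiff_linear, is_linear_snd.
Qed.

Lemma CCdiff_const (c : C) (p : CC) : CCdiff (fun _ : CC => c) p.
Proof.
apply ex_filterdiff_const.
Qed.

Lemma CCdiff_comp (h : C -> C) (f : CC -> C) (p : CC) :
  CCdiff f p -> Cdiff h (f p) -> CCdiff (fun q => h (f q)) p.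
Proof.
exact (ex_filterdiff_comp' (K := C_AbsRing) (U := CC) (V := C_NormedModule)
  (W := C_NormedModule) f h p).
Qed.

Lemma CCdiff_comp_2 (h : C -> C -> C) (f g : CC -> C) (p : CC) :
  CCdiff f p -> CCdiff g p ->
  CCdiff (fun q : CC => h (fst q) (snd q)) ((f p, g p) : CC) ->
  CCdiff (fun q => h (f q) (g q)) p.
Proof.
exact (ex_filterdiff_comp'_2 (K := C_AbsRing) (T := CC) (U := C_NormedModule)
  (V := C_NormedModule) (W := C_NormedModule) f g h p).
Qed.

Lemma norm_components (p : CC) :
  (Cmod (fst p) <= norm p /\ Cmod (snd p) <= norm p)%R.
Proof.
destruct p as [a b].
destruct (norm_prod (U := C_NormedModule) (V := C_NormedModule) a b) as [H _].
split; apply Rle_trans with (2 := H); [apply Rmax_l | apply Rmax_r].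
Qed.

Lemma CCdiff_of_quadratic_remainder (r K : R) (f : C -> C -> C) (x w a b : C) :
  (0 < r)%R -> (0 <= K)%R ->
  (forall x' w', (Cmod (x' - x) < r)%R -> (Cmod (w' - w) < r)%R ->
     (Cmod (f x' w' - f x w - (a * (x' - x) + b * (w' - w)))
        <= K * dist1 x w x' w' ^ 2)%R) ->
  CCdiff (fun q : CC => f (fst q) (snd q)) ((x, w) : CC).
Proof.
intros Hr HK T.
exists (fun h : CC => a * fst h + b * snd h).
apply (filterdiff_of_quadratic_remainder (U := CC) (V := C_NormedModule)
  _ _ _ r (4 * K)%R).
- apply (is_linear_comp (K := C_AbsRing) (U := CC) (V := CC)
    (W := C_NormedModule)
    (fun h : CC => (a * fst h, b * snd h)) (fun h : CC => fst h + snd h)).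
  + apply is_linear_prod.
    * exact (is_linear_comp _ _ (is_linear_fst (K := C_AbsRing))
        (is_linear_scal_r (V := C_NormedModule) a C_mult_comm)).
    * exact (is_linear_comp _ _ (is_linear_snd (K := C_AbsRing))
        (is_linear_scal_r (V := C_NormedModule) b C_mult_comm)).
  + exact (is_linear_plus (V := C_NormedModule)).
- exact Hr.
- intros [x' w'] Hy.
  destruct (norm_components (minus ((x', w') : CC) ((x, w) : CC))) as [N1 N2].
  set (N := norm (minus _ _)) in *.
  change (Cmod (x' - x) <= N)%R in N1; change (Cmod (w' - w) <= N)%R in N2.
  apply Rle_trans with (1 := T x' w' ltac:(lra) ltac:(lra)).
  pose proof (dist1_ge_0 x w x' w') as D0.
  assert (D : (dist1 x w x' w' <= 2 * N)%R) by (unfold dist1; lra).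
  assert (dist1 x w x' w' ^ 2 <= (2 * N) ^ 2)%R by (apply pow_incr; lra).
  nra.
Qed.

Lemma CCdiff_mult (f g : CC -> C) (p : CC) :
  CCdiff f p -> CCdiff g p -> CCdiff (fun q => f q * g q) p.
Proof.
intros Hf Hg; apply (CCdiff_comp_2 Cmult f g p Hf Hg).
apply (CCdiff_of_quadratic_remainder 1 1 Cmult _ _ (g p) (f p)); try lra.
intros x' w' _ _.
replace (_ - _ - _) with ((x' - f p) * (w' - g p)) by ring.
unfold dist1; rewrite Cmod_mult.
pose proof (Cmod_ge_0 (x' - f p)); pose proof (Cmod_ge_0 (w' - g p)); nra.
Qed.

Lemma locally_comp_pair (f g : CC -> C) (p : CC) (P : C -> C -> Prop) :
  CCdiff f p -> CCdiff g p ->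
  locally ((f p, g p) : CC) (fun q : CC => P (fst q) (snd q)) ->
  locally p (fun q => P (f q) (g q)).
Proof.
intros Hf Hg [e He].
apply filterdiff_continuous in Hf; apply filterdiff_continuous in Hg.
pose proof (Hf _ (locally_ball (f p) e)) as Bf.
pose proof (Hg _ (locally_ball (g p) e)) as Bg.
apply (filter_imp (F := locally p)
  (fun q => ball (f p) e (f q) /\ ball (g p) e (g q))).
- intros q [B1 B2]; exact (He (f q, g q) (conj B1 B2)).
- exact (filter_and (F := locally p) (fun q => ball (f p) e (f q))
    (fun q => ball (g p) e (g q)) Bf Bg).
Qed.

Lemma locally_Cmod_lt (r : R) (z : C) :
  (Cmod z < r)%R -> locally z (fun y : C => (Cmod y < r)%R).
Proof.
intros H; apply (locally_le_locally_norm (V := C_NormedModule) z).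
exists (mkposreal (r - Cmod z) ltac:(lra)); intros y Hy.
change (Cmod (y - z) < r - Cmod z)%R in Hy.
replace y with (z + (y - z)) by ring.
apply Rle_lt_trans with (1 := Cmod_triangle _ _); lra.
Qed.

Lemma locally_one_plus_neq_0 (z : C) :
  1 + z <> 0 -> locally z (fun y : C => 1 + y <> 0).
Proof.
intros H; apply (locally_le_locally_norm (V := C_NormedModule) z).
exists (mkposreal (Cmod (1 + z)) (proj1 (Cmod_gt_0 _) H)); intros y Hy Hy0.
change (Cmod (y - z) < Cmod (1 + z))%R in Hy.
replace (y - z) with (- (1 + z) + (1 + y)) in Hy by ring.
rewrite Hy0, Cplus_0_r, Cmod_opp in Hy; lra.
Qed.

Lemma locally_comp (f : CC -> C) (p : CC) (P : C -> Prop) :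
  CCdiff f p -> locally (f p) P -> locally p (fun q => P (f q)).
Proof.
intros Hf HP; exact (filterdiff_continuous f p Hf P HP).
Qed.

(** * Holomorphy of the limit *)

(** The points that k shifts (x, w) |-> (x, x w) bring into the bidisc without
    meeting the pole of phi on the way.  This is open for each k, whereas the
    condition 1 + x^n w <> 0 for all n is not visibly so. *)
Fixpoint regular (k : nat) (x w : C) : Prop :=
  match k with
  | O => bidisc x w
  | S m => (Cmod x < 1)%R /\ 1 + w <> 0 /\ regular m x (x * w)
  end.

Lemma CCdiff_shrink (p : CC) : CCdiff (fun q : CC => fst q * snd q) p.
Proof.
apply CCdiff_mult; [apply CCdiff_fst | apply CCdiff_snd].
Qed.

Lemma regular_open (k : nat) (x w : C) :
  regular k x w ->
  locally ((x, w) : CC) (fun q : CC => regular k (fst q) (snd q)).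
Proof.
revert w; induction k as [| k IH]; intros w H.
- destruct H as [Hx Hw]; apply filter_and.
  + exact (locally_comp _ _ _ (CCdiff_fst (x, w)) (locally_Cmod_lt _ _ Hx)).
  + exact (locally_comp _ _ _ (CCdiff_snd (x, w)) (locally_Cmod_lt _ _ Hw)).
- destruct H as (Hx & Hw & H); apply filter_and; [| apply filter_and].
  + exact (locally_comp _ _ _ (CCdiff_fst (x, w)) (locally_Cmod_lt _ _ Hx)).
  + exact (locally_comp _ _ _ (CCdiff_snd (x, w)) (locally_one_plus_neq_0 _ Hw)).
  + exact (locally_comp_pair _ _ (x, w) (regular k) (CCdiff_fst (x, w))
      (CCdiff_shrink (x, w)) (IH _ H)).
Qed.

(** In the bidisc this is the limit of the tame towers; otherwise the equation
    tower_lim x w = phi w * Cexp (tower_lim x (x w)) holds near the point and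
    lowers k. *)
Lemma tower_lim_diff (k : nat) (x w : C) :
  regular k x w ->
  CCdiff (fun q : CC => tower_lim (fst q) (snd q)) ((x, w) : CC).
Proof.
revert w; induction k as [| k IH]; intros w H.
- destruct (tangent_of_tame_limit (fun n x w => tower n x w 0) tower_lim
    tame_tower (fun x w H => tower_cvg x w 0 (proj1 H)) x w H) as (a & b & T).
  destruct H as [Hx Hw].
  apply (CCdiff_of_quadratic_remainder (Rmin (1 - Cmod x) (1 / 100 - Cmod w))
    1000 _ _ _ a b); [apply Rmin_pos; lra | lra |].
  intros x' w' Hx' Hw'; apply T.
  pose proof (Rmin_l (1 - Cmod x) (1 / 100 - Cmod w)).
  pose proof (Rmin_r (1 - Cmod x) (1 / 100 - Cmod w)).
  pose proof (Cmod_triangle x (x' - x)) as T1.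
  pose proof (Cmod_triangle w (w' - w)) as T2.
  replace (x + (x' - x)) with x' in T1 by ring.
  replace (w + (w' - w)) with w' in T2 by ring.
  split; lra.
- destruct H as (Hx & Hw & H).
  apply (ex_filterdiff_ext_locally
    (fun q : CC => phi (snd q) * Cexp (tower_lim (fst q) (fst q * snd q)))).
  + apply (filter_imp (F := locally ((x, w) : CC)))
      with (2 := locally_comp _ _ _ (CCdiff_fst (x, w)) (locally_Cmod_lt _ _ Hx)).
    intros q Hq; symmetry; now apply tower_lim_eq.
  + apply CCdiff_mult.
    * exact (CCdiff_comp phi _ (x, w) (CCdiff_snd _) (phi_diff w Hw)).
    * apply (CCdiff_comp Cexp); [| apply Cexp_diff].
      exact (CCdiff_comp_2 tower_lim _ _ (x, w) (CCdiff_fst _) (CCdiff_shrink _)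
        (IH _ H)).
Qed.

Lemma regular_of_nonzero (x w : C) :
  (Cmod x < 1)%R -> (forall n, 1 + x ^ n * w <> 0) -> exists k, regular k x w.
Proof.
intros Hx H.
destruct (pow_mul_small x w (1 / 100) Hx ltac:(lra)) as [k Hk]; exists k.
revert w H Hk; induction k as [| k IH]; intros w H Hk.
- split; [exact Hx |]; now replace w with (x ^ 0 * w) by (simpl; ring).
- split; [exact Hx | split].
  + now replace w with (x ^ 0 * w) by (simpl; ring).
  + apply IH.
    * intros n; replace (x ^ n * (x * w)) with (x ^ S n * w) by (simpl; ring).
      apply H.
    * now replace (x ^ k * (x * w)) with (x ^ S k * w) by (simpl; ring).
Qed.

(** * From the variables (s, lambda) to (x, w) *)

Lemma Cexp_eq_opp_1 (z : C) :
  1 + Cexp z = 0 -> exists k : Z, z = RtoC (IZR (2 * k + 1)) * RtoC PI * Ci.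
Proof.
intros H.
assert (Hc : (1 + exp (Re z) * cos (Im z) = 0)%R) by exact (f_equal Re H).
assert (Hs : (exp (Re z) * sin (Im z) = 0)%R).
{ rewrite <- (Rplus_0_l (_ * _)); exact (f_equal Im H). }
assert (Hm : Cmod (Cexp z) = 1%R).
{ replace (Cexp z) with (- (1)).
  - rewrite Cmod_opp; apply Cmod_1.
  - replace (Cexp z) with (- (1) + (1 + Cexp z)) by ring; rewrite H; ring. }
rewrite Cmod_Cexp in Hm; rewrite Hm in Hc, Hs.
assert (Hre : Re z = 0%R) by (apply exp_inv; now rewrite exp_0).
destruct (sin_eq_0_0 (Im z) ltac:(lra)) as [m Em].
destruct (Zeven_odd_dec m) as [Ev | Od].
- (* the cosine of an even multiple of PI is 1, not -1 *)
  exfalso; destruct (Zeven_ex m Ev) as [n ->].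
  assert (E : (cos (Im z) = 1)%R).
  { replace (Im z) with (2 * (IZR n * PI))%R by (rewrite Em, mult_IZR; ring).
    rewrite cos_2a_sin, (sin_eq_0_1 (IZR n * PI)) by (now exists n); ring. }
  lra.
- destruct (Zodd_ex m Od) as [k ->]; exists k.
  destruct z as [x y]; unfold Re, Im in *; simpl in Hre, Em; subst x y.
  apply injective_projections; simpl; ring.
Qed.

Lemma Cexp_opp_pow (lambda : C) (n : nat) :
  Cexp (- lambda) ^ n = Cexp (- (lambda * RtoC (INR n))).
Proof.
induction n as [| n IH].
- simpl; rewrite <- Cexp_0; f_equal; ring.
- rewrite S_INR, RtoC_plus; simpl; rewrite IH, <- Cexp_plus; f_equal; ring.
Qed.

(** The zeros of 1 + x^n w are the points with lambda (j - s) an odd multiple of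
    PI i, where j = n + 1 >= 1. *)
Lemma LL_nonzero (s lambda : C) (n : nat) :
  LL s lambda -> 1 + Cexp (- lambda) ^ n * Cexp (lambda * (s - 1)) <> 0.
Proof.
intros [_ H] E; rewrite Cexp_opp_pow, <- Cexp_plus in E.
destruct (Cexp_eq_opp_1 _ E) as [k Ek].
apply (H (Z.of_nat (S n)) (- k - 1)%Z ltac:(lia)).
replace (2 * (- k - 1) + 1)%Z with (- (2 * k + 1))%Z by ring.
rewrite opp_IZR, RtoC_opp, <- INR_IZR_INZ, S_INR, RtoC_plus.
replace (- RtoC (IZR (2 * k + 1)) * PI * Ci)
  with (- (RtoC (IZR (2 * k + 1)) * PI * Ci)) by ring.
rewrite <- Ek; ring.
Qed.

Lemma Cmod_Cexp_opp_lt_1 (z : C) : (0 < Re z -> Cmod (Cexp (- z)) < 1)%R.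
Proof.
intros H; rewrite Cmod_Cexp, <- exp_0; apply exp_increasing.
unfold Re in *; simpl; lra.
Qed.

Lemma LL_pred (s lambda : C) : LL s lambda -> LL (s - 1) lambda.
Proof.
intros [Hl H]; split; [exact Hl |]; intros j k Hj.
specialize (H (j + 1)%Z k ltac:(lia)).
rewrite plus_IZR, RtoC_plus in H.
replace (RtoC (IZR j) - (s - 1)) with (RtoC (IZR j) + 1 - s) by ring; exact H.
Qed.

(** The composition is defined by peeling off the innermost map, the tower by
    peeling off the outermost one. *)
Lemma compose_upto_shift (h : nat -> C -> C) (n : nat) (z : C) :
  compose_upto h (S n) z = h 1%nat (compose_upto (fun j => h (S j)) n z).
Proof.
revert z; induction n as [| n IH]; intros z; [reflexivity |].
exact (IH (h (S (S n)) z)).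
Qed.

Lemma compose_upto_ext (h h' : nat -> C -> C) (n : nat) (z : C) :
  (forall j y, h j y = h' j y) -> compose_upto h n z = compose_upto h' n z.
Proof.
intros H; revert z; induction n as [| n IH]; intros z; simpl; [reflexivity |].
now rewrite H.
Qed.

Lemma phi_Cexp (y u : C) :
  1 + Cexp y <> 0 -> Cexp u / (Cexp (- y) + 1) = phi (Cexp y) * Cexp u.
Proof.
intros H; rewrite Cexp_opp; unfold phi; field.
split; [exact H | apply Cexp_neq_0].
Qed.

Lemma compose_upto_tower (n : nat) (s lambda z : C) :
  LL s lambda ->
  compose_upto (beta_step s lambda) n z
  = tower n (Cexp (- lambda)) (Cexp (lambda * (s - 1))) z.
Proof.
revert s; induction n as [| n IH]; intros s H; [reflexivity |].
rewrite compose_upto_shift.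
rewrite (compose_upto_ext _ (beta_step (s - 1) lambda)).
- rewrite IH by now apply LL_pred.
  unfold beta_step at 1; simpl tower.
  rewrite <- Cexp_plus.
  replace (lambda * (RtoC (INR 1) - s)) with (- (lambda * (s - 1)))
    by (simpl INR; ring).
  replace (- lambda + lambda * (s - 1)) with (lambda * (s - 1 - 1)) by ring.
  apply phi_Cexp.
  pose proof (LL_nonzero s lambda 0 H) as E; simpl in E.
  now rewrite Cmult_1_l in E.
- intros j y; unfold beta_step; do 4 f_equal.
  rewrite S_INR, RtoC_plus; ring.
Qed.

(** * The logarithm of 1 + u *)

(** This is t <= tan t for t = acos c: the mean value theorem gives
    sin t = t cos t' with 0 < t' < t, and cos decreases. *)
Lemma acos_mul_le (c : R) :
  (0 < c <= 1 -> acos c * c <= sqrt (1 - c²))%R.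
Proof.
intros Hc.
destruct (acos_bound c) as [A0 A1].
rewrite <- (sin_acos c) by lra; rewrite <- (cos_acos c) at 2 by lra.
destruct (Rle_lt_or_eq_dec 0 (acos c) A0) as [Hp | E].
- destruct (MVT_cor2 sin cos 0 (acos c) Hp
    (fun t _ => derivable_pt_lim_sin t)) as (t & E & Ht).
  rewrite sin_0, !Rminus_0_r in E; rewrite E.
  assert (cos (acos c) <= cos t)%R by (apply cos_decr_1; lra).
  nra.
- rewrite <- E, sin_0; lra.
Qed.

Lemma Carg_le_PI (z : C) : (Rabs (Carg z) <= PI)%R.
Proof.
unfold Carg; pose proof (acos_bound (Re z / Cmod z)).
destruct (Rlt_dec (Im z) 0); apply Rabs_le; lra.
Qed.

Lemma Carg_le_slope (z : C) :
  (0 < Re z -> Rabs (Carg z) * Re z <= Rabs (Im z))%R.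
Proof.
intros Hz.
assert (Hm : (0 < Cmod z)%R).
{ pose proof (re_le_Cmod z); pose proof (Rle_abs (Re z)); lra. }
assert (Hle : (Re z <= Cmod z)%R)
  by (pose proof (re_le_Cmod z); pose proof (Rle_abs (Re z)); lra).
assert (Hsq : (Cmod z * Cmod z = Re z * Re z + Im z * Im z)%R).
{ unfold Cmod; rewrite sqrt_sqrt; unfold Re, Im; [ring | nra]. }
set (c := (Re z / Cmod z)%R).
assert (Hc : (0 < c <= 1)%R).
{ unfold c; split; [now apply Rdiv_lt_0_compat |].
  apply Rle_div_l; lra. }
assert (Ec : (c * Cmod z = Re z)%R) by (unfold c; field; lra).
assert (Ea : (Rabs (Carg z) = acos c)%R).
{ unfold Carg; fold c; pose proof (acos_bound c).
  destruct (Rlt_dec (Im z) 0); rewrite ?Rabs_Ropp; apply Rabs_pos_eq; lra. }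
assert (Es : (sqrt (1 - c²) * Cmod z = Rabs (Im z))%R).
{ rewrite <- (sqrt_Rsqr (Cmod z)) at 1 by lra.
  rewrite <- sqrt_mult_alt by (unfold Rsqr; nra).
  rewrite <- sqrt_Rsqr_abs; f_equal; unfold Rsqr; nra. }
rewrite Ea, <- Ec, <- Es, <- Rmult_assoc.
apply Rmult_le_compat_r; [lra | now apply acos_mul_le].
Qed.

(** Apply ln y <= y - 1 to y = t and to y = 1 / t. *)
Lemma Rabs_ln_le (t d : R) :
  (0 < d -> d <= t -> Rabs (ln t) <= Rabs (t - 1) * (1 + / d))%R.
Proof.
intros Hd Ht.
assert (L : forall y : R, (0 < y -> ln y <= y - 1)%R).
{ intros y Hy; pose proof (exp_ineq1_le (ln y)) as E.
  rewrite exp_ln in E by exact Hy; lra. }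
pose proof (L t ltac:(lra)) as L1.
pose proof (L (/ t)%R ltac:(apply Rinv_0_lt_compat; lra)) as L2.
rewrite ln_Rinv in L2 by lra.
assert (Hi : (/ t <= / d)%R) by (apply Rinv_le_contravar; lra).
assert (Hi0 : (0 < / t)%R) by (apply Rinv_0_lt_compat; lra).
replace (/ t - 1)%R with ((1 - t) * / t)%R in L2 by (field; lra).
unfold Rabs at 2; destruct (Rcase_abs (t - 1)); apply Rabs_le; split; nra.
Qed.

(** If |u| > 1/2, the argument is at most PI < 2 PI |u|.  If |u| <= 1/2, then
    Re (1 + u) >= 1/2 and the argument is at most |Im u| / Re (1 + u) <= 2 |u|. *)
Lemma Clog_one_plus_bound (delta : R) (u : C) :
  (0 < delta -> Cmod u < 1 -> delta <= Cmod (1 + u) ->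
   Cmod (Clog (1 + u)) <= (1 + / delta + 2 * PI) * Cmod u)%R.
Proof.
intros Hd Hu H1.
apply Rle_trans with (1 := Cmod_le_abs _).
change (Re (Clog (1 + u))) with (ln (Cmod (1 + u))).
change (Im (Clog (1 + u))) with (Carg (1 + u)).
assert (Hln : (Rabs (ln (Cmod (1 + u))) <= (1 + / delta) * Cmod u)%R).
{ apply Rle_trans with (1 := Rabs_ln_le _ _ Hd H1).
  rewrite Rmult_comm; apply Rmult_le_compat_l.
  - pose proof (Rinv_0_lt_compat _ Hd); lra.
  - apply Rabs_le; split.
    + pose proof (Cmod_sub_le (1 + u) u) as T.
      replace (1 + u - u) with (RtoC 1) in T by ring; rewrite Cmod_1 in T; lra.
    + pose proof (Cmod_triangle 1 u) as T; rewrite Cmod_1 in T; lra. }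
assert (Harg : (Rabs (Carg (1 + u)) <= 2 * PI * Cmod u)%R).
{ pose proof (Carg_le_PI (1 + u)) as P.
  destruct (Rle_dec (Cmod u) (1 / 2)) as [Hs | Hs]; [| pose proof PI_RGT_0; nra].
  assert (Hre : (1 / 2 <= Re (1 + u))%R).
  { pose proof (re_le_Cmod u) as R; apply Rabs_le_between in R.
    unfold Re in *; simpl; lra. }
  pose proof (Carg_le_slope (1 + u) ltac:(lra)) as S.
  assert (Him : (Rabs (Im (1 + u)) <= Cmod u)%R).
  { replace (Im (1 + u)) with (Im u) by (unfold Im; simpl; ring).
    apply im_le_Cmod. }
  pose proof (Rabs_pos (Carg (1 + u))); pose proof PI_RGT_0.
  pose proof PI2_3_2; pose proof (Cmod_ge_0 u).
  assert (Rabs (Carg (1 + u)) <= 2 * Cmod u)%R by nra.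
  nra. }
lra.
Qed.

(** * Existence of beta *)

Theorem theorem2p1 :
  exists beta : C -> C -> C,
    holomorphic2_on (fun s lambda : C => beta lambda s) LL /\
    (forall s lambda : C, LL s lambda ->
       is_infinite_composition (beta_step s lambda) (beta lambda s)) /\
    (forall s lambda : C, LL s lambda -> LL (s + 1) lambda ->
       beta lambda (s + 1) =
         Cexp (beta lambda s) / (Cexp (- (lambda * s)) + 1)) /\
    (forall lambda : C, (0 < Re lambda)%R ->
       forall delta : R, (0 < delta)%R ->
         bigO_infty_within (asymptotic_domain lambda delta)
           (fun s => log_beta_succ beta lambda s - beta lambda s)
           (fun s => Cexp (- (lambda * s)))).
Proof.
exists (fun lambda s => tower_lim (Cexp (- lambda)) (Cexp (lambda * (s - 1)))).
repeat split.
- intros s lambda H.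
  destruct (regular_of_nonzero (Cexp (- lambda)) (Cexp (lambda * (s - 1))))
    as [k Hk].
  { apply Cmod_Cexp_opp_lt_1, H. }
  { intros n; now apply LL_nonzero. }
  assert (Dx : forall p : CC, CCdiff (fun q : CC => Cexp (- snd q)) p).
  { intros p; apply (CCdiff_comp Cexp); [| apply Cexp_diff].
    exact (ex_filterdiff_opp_fct (K := C_AbsRing) (U := CC) (V := C_NormedModule)
      _ (CCdiff_snd p)). }
  assert (Dw : forall p : CC,
            CCdiff (fun q : CC => Cexp (snd q * (fst q - 1))) p).
  { intros p; apply (CCdiff_comp Cexp); [| apply Cexp_diff].
    apply CCdiff_mult; [apply CCdiff_snd |].
    exact (ex_filterdiff_minus_fct (K := C_AbsRing) (U := CC)
      (V := C_NormedModule) _ _ (CCdiff_fst p) (CCdiff_const 1 p)). }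
  pose proof (locally_comp_pair _ _ (s, lambda) (regular k)
    (Dx _) (Dw _) (regular_open k _ _ Hk)) as L.
  apply (filter_imp (F := locally ((s, lambda) : CC))) with (2 := L).
  intros p Hp; apply (CCdiff_comp_2 tower_lim _ _ p (Dx p) (Dw p)).
  exact (tower_lim_diff k _ _ Hp).
- intros s lambda H z.
  apply (filterlim_ext
    (fun n => tower n (Cexp (- lambda)) (Cexp (lambda * (s - 1))) z)).
  + intros n; symmetry; now apply compose_upto_tower.
  + apply tower_cvg, Cmod_Cexp_opp_lt_1, H.
- intros s lambda H H'.
  rewrite tower_lim_eq by (apply Cmod_Cexp_opp_lt_1, H).
  pose proof (LL_nonzero _ _ 0 H') as E; simpl in E.
  rewrite Cmult_1_l in E.
  rewrite <- Cexp_plus.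
  replace (s + 1 - 1) with s in * by ring.
  replace (- lambda + lambda * s) with (lambda * (s - 1)) by ring.
  symmetry; now apply phi_Cexp.
- intros lambda _ delta Hd.
  exists (1 + / delta + 2 * PI)%R, 0%R; intros s (Hre & _ & _ & Hs) _.
  unfold log_beta_succ.
  replace (_ - _ - _) with (- Clog (1 + Cexp (- (lambda * s)))) by ring.
  rewrite Cmod_opp; apply Clog_one_plus_bound; [exact Hd | | exact Hs].
  now apply Cmod_Cexp_opp_lt_1.
Qed.
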